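(* Let $L$ be a Latin square of odd order $n$. Then for any $r,c\in[n]$, $$t_{rc} \equiv E_n \pmod 2.$$
   Context: A Latin square of order $n$ is an $n\times n$ matrix with symbols from $[n]=\{1,\dots,n\}$ in which each symbol appears exactly once in each row and exactly once in each column. $E_n=E_n(L)$ is the number of transversals of $L$, i.e. selections of $n$ entries (cells), one from each row and one from each column, whose $n$ symbols are all distinct. For $i,j\in[n]$, $t_{ij}=t_{ij}(L)$ is the number of transversals in the $(n-1)\times(n-1)$ array obtained by deleting row $i$ and column $j$ from $L$; here a transversal of an $(n-1)\times(n-1)$ array is a selection of $n-1$ entries, no two of which share their row, column or symbol. *)

(* Defs.v *)
From mathcomp Require Import all_boot all_algebra.

Set Implicit Arguments.
Unset Strict Implicit.
Unset Printing Implicit Defensive.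

(* Rows, columns and symbols are all indexed by 'I_n = {0, ..., n-1}. *)
Definition latin_square (n : nat) (L : 'M['I_n]_n) : Prop :=
  (forall i s : 'I_n, exists! j : 'I_n, L i j = s) /\
  (forall j s : 'I_n, exists! i : 'I_n, L i j = s).

(* A selection of entries is a set of cells (row, column).  The symbols of the
   m x m array A come from an arbitrary T, since deleting a row and a column
   from a Latin square of order n leaves an array of order n - 1 on n symbols.
   For m = 0 the empty selection is the only transversal. *)
Definition transversal (T : eqType) (m : nat) (A : 'M[T]_m)
    (S : {set 'I_m * 'I_m}) : bool :=
  (#|S| == m) &&
  [forall p in S, forall q in S, (p != q) ==>
     [&& p.1 != q.1, p.2 != q.2 & A p.1 p.2 != A q.1 q.2]].

Definition num_transversals (T : eqType) (m : nat) (A : 'M[T]_m) : nat :=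
  #|[set S : {set 'I_m * 'I_m} | transversal A S]|.

Definition minor_transversals (n : nat) (L : 'M['I_n]_n) (r c : 'I_n) : nat :=
  num_transversals (row' r (col' c L)).

(* The other usual definition: one cell from each row and one from each column,
   with distinct symbols. *)
Lemma transversalP (T : eqType) (m : nat) (A : 'M[T]_m)
    (S : {set 'I_m * 'I_m}) :
  reflect
    [/\ forall i, #|[set p in S | p.1 == i]| = 1,
        forall j, #|[set p in S | p.2 == j]| = 1
      & {in S &, injective (fun p => A p.1 p.2)}]
    (transversal A S).
Proof.
have fib (f : 'I_m * 'I_m -> 'I_m) : #|S| = m -> {in S &, injective f} ->
    forall i, #|[set p in S | f p == i]| = 1.
  move=> cS fI i.
  have /eqP fS : f @: S == setT.
    by rewrite eqEcard subsetT cardsT card_ord card_in_imset // cS /=.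
  have /imsetP[p pS ->] : i \in f @: S by rewrite fS inE.
  apply/eqP/cards1P; exists p; apply/setP=> q; rewrite !inE.
  apply/andP/eqP=> [[qS /eqP /fI ->] //|-> //].
have fibI (f : 'I_m * 'I_m -> 'I_m) :
    (forall i, #|[set p in S | f p == i]| = 1) -> {in S &, injective f}.
  move=> f1 p q pS qS fpq.
  have /eqP/cards1P[x xE] := f1 (f q).
  have : p \in [set x] by rewrite -xE inE pS fpq eqxx.
  have : q \in [set x] by rewrite -xE inE qS eqxx.
  by rewrite !inE => /eqP-> /eqP->.
apply: (iffP andP) => [[/eqP cS /forall_inP H] | [H1 H2 H3]].
  have K p q : p \in S -> q \in S -> p != q ->
      [&& p.1 != q.1, p.2 != q.2 & A p.1 p.2 != A q.1 q.2].
    by move=> pS qS; have /forall_inP/(_ q qS)/implyP := H p pS.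
  split; [apply: (fib fst) => // | apply: (fib snd) => // |];
    move=> p q pS qS E; apply/eqP; apply: contraT => /(K _ _ pS qS)/and3P[];
    by rewrite E eqxx.
have I1 := fibI fst H1; have I2 := fibI snd H2; split.
  rewrite -(card_in_imset I1) -[X in _ == X]card_ord -cardsT; apply/eqP.
  congr #|pred_of_set _|; apply/setP=> i; rewrite [RHS]inE.
  have /eqP/cards1P[x xE] := H1 i.
  have : x \in [set x] by rewrite inE.
  by rewrite -xE inE => /andP[xS /eqP<-]; apply: imset_f.
apply/forall_inP=> p pS; apply/forall_inP=> q qS; apply/implyP=> npq.
by apply/and3P; split; apply: contra_neq npq; [apply: I1|apply: I2|apply: H3].
Qed.

(* Main.v *)
Require Import Defs.
From mathcomp Require Import all_boot all_algebra all_fingroup.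

(** The count takes place in the field with two elements, where a determinant
    is a sum over all diagonals without signs.  For a set [B] of symbols let
    [M_B] be the 0/1 matrix marking the cells of [L] whose symbol lies in [B],
    and let [E] be the number of transversals of [L] and [t] that of the minor
    without row [r] and column [c].

    Modulo 2, the number of sets [B] containing a given set [X] of symbols is
    1 if [X] consists of all symbols and 0 otherwise, and the sum of the
    numbers [#|~: B|] over these [B] is 1 if [X] misses exactly one symbol and
    0 otherwise.  Taking for [X] the set of symbols on a diagonal of [L],
    respectively of the minor, and summing over all diagonals gives
      [E = \sum_B \det M_B]  and
      [t = \sum_B #|~: B| * \det (minor of M_B)]
    ([num_transversals_det] with two choices of weights).

    Replace [B] by its complement in the first sum; then the two sums agree
    term by term ([det_symbol_mxC]).  All row and column sums of [M_(~: B)] are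
    [#|~: B|], so both terms vanish when this number is even.  When it is odd,
    [#|B|] is even because [n] is odd, hence [M_B] has zero row and column
    sums, while [M_(~: B)] is [M_B] plus the all-ones matrix.  Temperley's
    identity [det_addJ] says that its determinant is [n ^ 2] times any cofactor
    of [M_B], and [n ^ 2] is odd. *)

Set Implicit Arguments.
Unset Strict Implicit.
Unset Printing Implicit Defensive.

Import GRing.Theory.
Local Open Scope ring_scope.

(** * Determinants of matrices with constant row and column sums *)

Section LineSums.

Variables (R : comNzRingType) (n : nat).
Implicit Types A B : 'M[R]_n.

(** Adding all rows of [A] to row [r] does not change the determinant; the
    right-hand side is the expansion along that new row. *)
Lemma det_col_sums A r : \det A = \sum_j (\sum_i A i j) * cofactor A r j.
Proof.
transitivity (\sum_i (A *m \adj A) i r).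
  rewrite mul_mx_adj (bigD1 r) //= big1 => [|i ir]; last first.
    by rewrite mxE (negPf ir).
  by rewrite mxE eqxx addr0.
under eq_bigr do rewrite mxE.
rewrite exchange_big; apply: eq_bigr => j _ /=.
by rewrite mulr_suml; apply: eq_bigr => i _; rewrite [\adj A _ _]mxE.
Qed.

Lemma det_row_sums A c : \det A = \sum_i (\sum_j A i j) * cofactor A i c.
Proof.
rewrite -det_tr (det_col_sums _ c); apply: eq_bigr => i _.
by rewrite cofactor_tr; under eq_bigr do rewrite mxE.
Qed.

Lemma det_sub_row A B r :
    (forall j, B r j = A r j) ->
    (forall i j, i != r -> B i j = A i j - A r j) ->
  \det B = \det A.
Proof.
move=> Br Bi.
pose E : 'M[R]_n :=
  \matrix_(i, j) ((i == j)%:R - ((i != r) && (j == r))%:R).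
have -> : B = E *m A.
  apply/matrixP=> i j; rewrite mxE.
  under eq_bigr do rewrite mxE mulrBl.
  rewrite sumrB (bigD1 i) //= eqxx mul1r big1 ?addr0 => [|k ki]; last first.
    by rewrite eq_sym (negPf ki) mul0r.
  have [->|ir] := eqVneq i r.
    by rewrite Br big1 ?subr0 // => k _; rewrite mul0r.
  rewrite Bi // (bigD1 r) //= eqxx mul1r big1 ?addr0 // => k kr.
  by rewrite (negPf kr) mul0r.
(* Row [r] of [E] is that of the identity, and so is the corresponding minor. *)
rewrite det_mulmx (expand_det_row E r) (bigD1 r) //=.
rewrite big1 => [|j jr]; last first.
  by rewrite !mxE eqxx eq_sym (negPf jr) subr0 mul0r.
have E1 : row' r (col' r E) = 1%:M.
  apply/matrixP=> i j; rewrite !mxE.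
  rewrite [lift r j == r]eq_sym (negPf (neq_lift r j)) andbF subr0.
  by rewrite (inj_eq lift_inj).
rewrite mxE !eqxx /cofactor E1 det1 addnn -signr_odd odd_double.
by rewrite subr0 !mul1r addr0 mul1r.
Qed.

(** Temperley's identity.  As all column sums of [B + J] are [n], its
    determinant is [n] times that of [B + J] with row [r] replaced by ones.
    Subtracting this row from the others restores the rows of [B]; the only
    row of the result that has a nonzero sum is now row [r], with sum [n], and
    the row version of the expansion gives the second factor [n]. *)
Lemma det_addJ B r c :
    (forall i, \sum_j B i j = 0) -> (forall j, \sum_i B i j = 0) ->
  \det (B + const_mx 1) = (n ^ 2)%:R * cofactor B r c.
Proof.
move=> Brow Bcol.
pose ones_at_r (M : 'M[R]_n) : 'M[R]_n :=
  \matrix_(i, j) (if i == r then 1 else M i j).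
have row'_ones M : row' r (ones_at_r M) = row' r M.
  by apply/matrixP=> i j; rewrite !mxE eq_sym (negPf (neq_lift r i)).
have cof_ones M j : cofactor (ones_at_r M) r j = cofactor M r j.
  rewrite /cofactor; congr (_ * \det _).
  apply/matrixP=> i k.
  by have /matrixP/(_ i (lift j k)) := row'_ones M; rewrite !mxE.
have sum1 : \sum_(i < n) 1 = n%:R :> R by rewrite sumr_const card_ord.
transitivity (n%:R * \det (ones_at_r (B + const_mx 1))).
  rewrite (det_col_sums _ r) (expand_det_row _ r) mulr_sumr.
  apply: eq_bigr => j _; rewrite cof_ones !mxE eqxx mul1r; congr (_ * _).
  under eq_bigr do rewrite !mxE.
  by rewrite big_split /= Bcol sum1 add0r.
have -> : \det (ones_at_r (B + const_mx 1)) = \det (ones_at_r B).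
  apply/esym/(@det_sub_row _ _ r) => [j|i j ir]; rewrite !mxE eqxx //.
  by rewrite (negPf ir) addrK.
rewrite (det_row_sums _ c) (bigD1 r) //=.
rewrite [X in _ * (_ + X)]big1 => [|i ir]; last first.
  by under eq_bigr do rewrite mxE (negPf ir); rewrite Brow mul0r.
under eq_bigr do rewrite mxE eqxx.
by rewrite sum1 cof_ones addr0 mulrA natrX expr2.
Qed.

End LineSums.

(** * Inclusion-exclusion modulo 2 *)

Local Notation F2 := 'F_2.

Lemma natr_odd_F2 k : k%:R = (odd k)%:R :> F2.
Proof. by apply/val_inj; rewrite /= !val_Fp_nat // !modn2 oddb. Qed.

Lemma eq_mod2_F2 k l : k%:R = l%:R :> F2 -> k = l %[mod 2].
Proof. by move/(congr1 val); rewrite /= !val_Fp_nat. Qed.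

Lemma signr_F2 k : (-1) ^+ k = 1 :> F2.
Proof. by rewrite (_ : -1 = 1) ?expr1n //; apply/val_inj. Qed.

Section SupersetSums.

Variable T : finType.
Implicit Types X Y B : {set T}.

(** Element by element, the number of [B] between [X] and [Y] is a product of
    factors [(x \in Y) + (x \notin X)], and modulo 2 such a factor is nonzero
    only if [x] lies in both or in none of [X] and [Y]. *)
Lemma sum_interval_F2 X Y :
  \sum_(B : {set T}) ((X \subset B) && (B \subset Y))%:R = (X == Y)%:R :> F2.
Proof.
transitivity (\prod_x ((x \in Y)%:R + (x \notin X)%:R) : F2).
  rewrite bigA_distr; apply: eq_bigr => B _.
  have [/andP[/subsetP XB /subsetP BY]|nXBY] := boolP (_ && _).
    rewrite big1 // => x _; case: ifP => [/BY->//|/negbT xB].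
    by rewrite (contra (XB x)).
  move: nXBY; rewrite negb_and => /orP[] /subsetPn[x xX xB].
    by rewrite (bigD1 x) //= (negPf xB) xX mul0r.
  by rewrite (bigD1 x) //= xX (negPf xB) mul0r.
have [<-|nXY] := eqVneq X Y.
  by rewrite big1 // => x _; case: (x \in X); rewrite ?addr0 ?add0r.
have /existsP[x nx] : [exists x, (x \in X) != (x \in Y)].
  apply: contraR nXY; rewrite negb_exists => /forallP eXY.
  by apply/eqP/setP=> x; apply/eqP; have := eXY x; rewrite negbK.
rewrite (bigD1 x) //=; case: (x \in X) (x \in Y) nx => [] [] //= _.
  by rewrite addr0 mul0r.
by rewrite [1 + 1](_ : _ = 0) ?mul0r //; apply/val_inj.
Qed.

Lemma sum_supersets_F2 X :
  \sum_(B : {set T}) (X \subset B)%:R = (#|X| == #|T|)%:R :> F2.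
Proof.
have -> : (#|X| == #|T|) = (X == [set: T]).
  by rewrite -cardsT eqEcard subsetT eqn_leq subset_leq_card ?subsetT.
rewrite -sum_interval_F2; apply: eq_bigr => B _.
by rewrite subsetT andbT.
Qed.

(** [#|~: B|] counts the points [x] with [B] contained in the complement of
    [x], so this is the sum over [x] of the numbers of sets between [X] and
    that complement. *)
Lemma sum_supersets_cardC_F2 X :
  \sum_(B : {set T}) #|~: B|%:R * (X \subset B)%:R = (#|X|.+1 == #|T|)%:R :> F2.
Proof.
transitivity (\sum_x (X == ~: [set x])%:R : F2).
  under [RHS]eq_bigr do rewrite -sum_interval_F2.
  rewrite exchange_big; apply: eq_bigr => B _ /=.
  rewrite -sum1_card natr_sum mulr_suml big_mkcond /=.
  apply: eq_bigr => x _; rewrite subsetC sub1set inE mulr1n.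
  by case: (x \in B); rewrite /= ?andbT ?andbF ?mul1r.
have -> : (#|X|.+1 == #|T|) = (#|~: X| == 1%N).
  by rewrite -(cardsC X) -addn1 eqn_add2l eq_sym.
have [/cards1P[y XCy]|nX1] := boolP (#|~: X| == 1%N).
  rewrite (bigD1 y) //= -{1}[X]setCK XCy eqxx big1 ?addr0 // => x xy.
  rewrite -[X]setCK XCy (inj_eq (@setC_inj T)) (inj_eq (@set1_inj T)).
  by rewrite eq_sym (negPf xy).
rewrite big1 // => x _; case: eqP => // XE; case/negP: nX1.
by rewrite XE setCK cards1.
Qed.

End SupersetSums.

(** * Transversals as sums of determinants *)

Definition symbol_mx (T : finType) m (A : 'M[T]_m) (B : {set T}) : 'M[F2]_m :=
  map_mx (fun x => (x \in B)%:R) A.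

Lemma num_transversals_perm (T : eqType) m (A : 'M[T]_m) :
  num_transversals A = #|[set s : 'S_m | injectiveb (fun i => A i (s i))]|.
Proof.
pose graph (s : 'S_m) : {set 'I_m * 'I_m} := [set (i, s i) | i : 'I_m].
have graphE s p : (p \in graph s) = (s p.1 == p.2).
  apply/imsetP/eqP => [[i _ ->]//|]; case: p => i j /= <-.
  by exists i.
have graph_inj : injective graph.
  move=> s t est; apply/permP=> i; apply/eqP.
  by rewrite eq_sym -(graphE t (i, s i)) -est graphE.
rewrite /num_transversals -(card_imset _ graph_inj).
congr #|pred_of_set _|; apply/setP=> S; rewrite inE; apply/idP/imsetP.
  move=> trS; have /andP[/eqP cS _] := trS.
  have /Defs.transversalP[H1 H2 H3] := trS.
  have cell i : exists j, (i, j) \in S.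
    have /eqP/cards1P[[i' j] E] := H1 i.
    have : (i', j) \in [set (i', j)] by rewrite inE.
    by rewrite -E inE => /andP[jS /= /eqP<-]; exists j.
  pose f i := xchoose (cell i).
  have fS i : (i, f i) \in S := xchooseP (cell i).
  have f_inj : injective f.
    move=> i k fik.
    have /eqP/cards1P[p E] := H2 (f i).
    have : (i, f i) \in [set p] by rewrite -E inE fS /=.
    have : (k, f k) \in [set p] by rewrite -E inE fS /= fik.
    by rewrite !inE => /eqP<- /eqP[].
  exists (perm f_inj).
    rewrite inE; apply/injectiveP => i k; rewrite !permE => Aik.
    by have [] := H3 _ _ (fS i) (fS k) Aik.
  apply/esym/eqP; rewrite eqEcard cS card_imset ?card_ord => [|i k []//].
  rewrite leqnn andbT; apply/subsetP=> p /imsetP[i _ ->].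
  by rewrite permE.
move=> [s]; rewrite inE => /injectiveP s_inj ->.
rewrite /Defs.transversal card_imset ?card_ord ?eqxx => [|i k []//].
apply/forall_inP=> p /imsetP[i _ ->]; apply/forall_inP=> q /imsetP[k _ ->].
apply/implyP=> npq; have ik : i != k by apply: contra_neq npq => ->.
by rewrite /= ik (inj_eq perm_inj) ik (inj_eq s_inj) ik.
Qed.

(** Modulo 2 the determinant of [symbol_mx A B] counts the diagonals of [A]
    with all symbols in [B].  The hypothesis on the weights [w] makes a diagonal
    with symbol set [X] contribute 1 exactly when it has [m] distinct
    symbols. *)
Lemma num_transversals_det (T : finType) m (A : 'M[T]_m) (w : {set T} -> F2) :
    (forall X : {set T},
      \sum_(B : {set T}) w B * (X \subset B)%:R = (#|X| == m)%:R) ->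
  (num_transversals A)%:R = \sum_(B : {set T}) w B * \det (symbol_mx A B).
Proof.
move=> sum_w; under eq_bigr do rewrite /determinant mulr_sumr.
rewrite exchange_big num_transversals_perm -sum1_card natr_sum big_mkcond /=.
apply: eq_bigr => s _; pose X := [set A i (s i) | i : 'I_m].
transitivity ((#|X| == m)%:R : F2).
  have -> : (#|X| == m) = injectiveb (fun i => A i (s i)).
    rewrite -[X in _ == X](card_ord m).
    apply/imset_injP/injectiveP => [f_inj i k|f_inj i k _ _]; last exact: f_inj.
    exact: f_inj.
  by rewrite inE; case: (injectiveb _).
rewrite -sum_w; apply: eq_bigr => B _; congr (_ * _); rewrite signr_F2 mul1r.
have [/subsetP XB|/subsetPn[x /imsetP[i _ ->] xB]] := boolP (X \subset B).
  by rewrite big1 // => i _; rewrite mxE XB //; apply/imsetP; exists i.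
by rewrite (bigD1 i) //= mxE (negPf xB) mul0r.
Qed.

(** * Latin squares *)

Lemma sum_mem_F2 (T : finType) (f : T -> T) (B : {set T}) :
  injective f -> \sum_i (f i \in B)%:R = #|B|%:R :> F2.
Proof.
move=> f_inj; rewrite -sum1_card natr_sum [RHS]big_mkcond /=.
rewrite [RHS](reindex_inj f_inj) /=; apply: eq_bigr => i _.
by case: (f i \in B).
Qed.

Section LatinSquare.

Variables (n : nat) (L : 'M['I_n]_n).
Hypothesis L_latin : latin_square L.

Lemma symbol_mx_row_sum B i : \sum_j symbol_mx L B i j = #|B|%:R.
Proof.
under eq_bigr do rewrite mxE; apply: sum_mem_F2 => j k Ljk.
have [Lrow _] := L_latin; have [l [_ ul]] := Lrow i (L i k).
by rewrite -(ul k) // -(ul j).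
Qed.

Lemma symbol_mx_col_sum B j : \sum_i symbol_mx L B i j = #|B|%:R.
Proof.
under eq_bigr do rewrite mxE.
apply: (@sum_mem_F2 _ (fun i => L i j)) => i k Lik.
have [_ Lcol] := L_latin; have [l [_ ul]] := Lcol j (L k j).
by rewrite -(ul k) // -(ul i).
Qed.

Lemma symbol_mxC B : symbol_mx L (~: B) = symbol_mx L B + const_mx 1.
Proof.
apply/matrixP=> i j; rewrite !mxE inE.
by case: (_ \in B); rewrite /= ?add0r //; apply/val_inj.
Qed.

(** The left-hand side is the term of [~: B] in the sum for the transversals
    of [L], the right-hand side that of [B] in the sum for the minor.  For
    [#|~: B|] even both are zero; otherwise [#|B|] is even and [det_addJ]
    applies to the matrix of [B], whose lines sum to zero. *)
Lemma det_symbol_mxC (r c : 'I_n) (B : {set 'I_n}) :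
    odd n ->
  \det (symbol_mx L (~: B)) =
  #|~: B|%:R * \det (symbol_mx (row' r (col' c L)) B).
Proof.
move=> n_odd; rewrite natr_odd_F2.
have [CB_odd|CB_even] := boolP (odd #|~: B|); last first.
  rewrite mul0r (det_col_sums _ r) big1 // => j _.
  by rewrite symbol_mx_col_sum natr_odd_F2 (negPf CB_even) mul0r.
have B_even : #|B|%:R = 0 :> F2.
  rewrite natr_odd_F2; have := congr1 odd (cardsC B).
  by rewrite card_ord n_odd oddD CB_odd; case: (odd _).
rewrite symbol_mxC (det_addJ r c) => [|i|j]; last 2 first.
- by rewrite symbol_mx_row_sum B_even.
- by rewrite symbol_mx_col_sum B_even.
rewrite (natr_odd_F2 (n ^ 2)%N) oddX n_odd /cofactor signr_F2 !mul1r /symbol_mx.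
by rewrite map_row' map_col'.
Qed.

End LatinSquare.

Theorem theorem28 (n : nat) (L : 'M['I_n]_n) (n_odd : odd n)
    (L_latin : latin_square L) (r c : 'I_n) :
  minor_transversals L r c = num_transversals L %[mod 2].
Proof.
apply: eq_mod2_F2; rewrite /minor_transversals.
rewrite (@num_transversals_det _ _ _ (fun B => #|~: B|%:R)) => [|X]; last first.
  rewrite sum_supersets_cardC_F2 card_ord.
  by rewrite -[in RHS]eqSS (ltn_predK (ltn_ord r)).
rewrite (@num_transversals_det _ _ _ (fun=> 1)) => [|X]; last first.
  by under eq_bigr do rewrite mul1r; rewrite sum_supersets_F2 card_ord.
rewrite [RHS](reindex_inj (@setC_inj _)) /=; apply: eq_bigr => B _.
by rewrite mul1r (det_symbol_mxC L_latin r c).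
Qed.
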